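(* Consider a port-Hamiltonian descriptor system $$E\dot x=(J-R)x+(G-P)u,\qquad y=(G+P)^Tx+(S+N)u,$$ with real coefficient matrices $E,J,R\in\mathbb{R}^{n\times n}$, $G,P\in\mathbb{R}^{n\times m}$, $S,N\in\mathbb{R}^{m\times m}$ (so that the structural conditions in the definition of a port-Hamiltonian descriptor system hold). For $F\in\mathbb{R}^{m\times n}$ let $$\tilde J=J+\tfrac12[(G-P)F-F^T(G-P)^T],\qquad \tilde R=R-\tfrac12[(G-P)F+F^T(G-P)^T],$$ $$\tilde G=G+\tfrac12F^T(S+N)^T,\qquad \tilde P=P+\tfrac12F^T(S+N)^T,$$ so that the state feedback $u=Fx+v$ yields the closed-loop system $$E\dot x=(\tilde J-\tilde R)x+(\tilde G-\tilde P)v,\qquad y=(\tilde G+\tilde P)^Tx+(S+N)v.$$ There exists a matrix $F\in\mathbb{R}^{m\times n}$ such that the closed-loop system is port-Hamiltonian (with coefficients $E,\tilde J,\tilde R,\tilde G,\tilde P,S,N$) and the pencil $sE-(\tilde J-\tilde R)$ is regular, of index at most one, and has all its finite eigenvalues in the open left half plane $\mathbb{C}_-$, if and only if the following two conditions hold: $$\operatorname{rank}\begin{bmatrix} sE-(J-R) & (G-P)(S+N)^{(+)}\mathcal{R}(S) & (G-P)\mathcal{S}_\infty(S+N)\end{bmatrix}=n\quad\text{for all } s\in\mathbb{C}_0,$$ and $$\operatorname{rank}\begin{bmatrix} E & (J-R)\mathcal{S}_\infty(E) & (G-P)(S+N)^{(+)}\mathcal{R}(S) & (G-P)\mathcal{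S}_\infty(S+N)\end{bmatrix}=n.$$
   Context: A linear time-invariant descriptor system $E\dot x=(J-R)x+(G-P)u$, $y=(G+P)^Tx+(S+N)u$ with $E,J,R\in\mathbb{R}^{n\times n}$, $G,P\in\mathbb{R}^{n\times m}$, $S,N\in\mathbb{R}^{m\times m}$, $S=S^T$, $N=-N^T$, is called port-Hamiltonian if $$E=E^T\ge 0,\qquad \begin{bmatrix} J & G\\ -G^T & N\end{bmatrix}=-\begin{bmatrix} J & G\\ -G^T & N\end{bmatrix}^T,\qquad \begin{bmatrix} R & P\\ P^T & S\end{bmatrix}=\begin{bmatrix} R & P\\ P^T & S\end{bmatrix}^T\ge 0.$$ Here $M\ge 0$ ($M>0$) means that the symmetric matrix $M$ is positive semi-definite (positive definite). $\mathbb{C}_-$ is the open left half complex plane and $\mathbb{C}_0$ is the imaginary axis. For a matrix $M$, $\mathcal{S}_\infty(M)$ denotes a matrix with orthonormal columns spanning the right nullspace of $M$, $\mathcal{R}(M)$ denotes a matrix with orthonormal columns spanning the range (column space) of $M$ (either may have zero columns), and $M^{(+)}$ denotes the Moore-Penrose inverse of $M$. A square pencil $sE-A$ is regular if $\det(sE-A)$ is not identically zero as a polynomial in $s$. Its finite eigenvalues are the $\lambda\in\mathbb{C}$ with $\det(\lambda E-A)=0$. The index of a regular pencil is the size of the largest Jordan block associated with the eigenvalue $\infty$ in its Kronecker/Weierstrass canonical form (and is $0$ if $E$ is nonsingular). *)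

(* Defs.v *)
From mathcomp Require Import all_boot all_order all_algebra.
From mathcomp Require Import complex reals.

Set Implicit Arguments.
Unset Strict Implicit.
Unset Printing Implicit Defensive.

Import Order.TTheory GRing.Theory Num.Theory.

Local Open Scope ring_scope.

Notation complexify M := (map_mx (real_complex _) M).

Definition psd (K : realType) (n : nat) (M : 'M[K]_n) : Prop :=
  M^T = M /\ forall x : 'cV[K]_n, 0 <= (x^T *m M *m x) 0 0.

(* The row space of Q^T is the column space of Q, and kermx M^T is the (row)
   kernel of M^T, i.e. the transposed right nullspace of M. A matrix Q with
   zero columns is allowed; Q is not unique. *)
Definition orthonormal_null_basis (K : realType) (p q k : nat)
    (M : 'M[K]_(p, q)) (Q : 'M[K]_(q, k)) : Prop :=
  Q^T *m Q = 1%:M /\ (Q^T == kermx M^T)%MS.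

Definition orthonormal_range_basis (K : realType) (p q k : nat)
    (M : 'M[K]_(p, q)) (Q : 'M[K]_(p, k)) : Prop :=
  Q^T *m Q = 1%:M /\ (Q^T == M^T)%MS.

(* The four Penrose equations, which determine X uniquely. *)
Definition moore_penrose (K : realType) (p q : nat)
    (M : 'M[K]_(p, q)) (X : 'M[K]_(q, p)) : Prop :=
  [/\ M *m X *m M = M, X *m M *m X = X,
      (M *m X)^T = M *m X & (X *m M)^T = X *m M].

Definition port_hamiltonian (K : realType) (n m : nat) (E J R : 'M[K]_n)
    (G P : 'M[K]_(n, m)) (S N : 'M[K]_m) : Prop :=
  [/\ S = S^T, N = - N^T, psd E,
      block_mx J G (- G^T) N = - (block_mx J G (- G^T) N)^T
    & psd (block_mx R P P^T S)].

Section Feedback.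
Variables (K : realType) (n m : nat).
Implicit Types (J R : 'M[K]_n) (G P : 'M[K]_(n, m)) (S N : 'M[K]_m)
  (F : 'M[K]_(m, n)).

Definition closed_J J G P F : 'M[K]_n :=
  J + 2^-1 *: ((G - P) *m F - F^T *m (G - P)^T).

Definition closed_R R G P F : 'M[K]_n :=
  R - 2^-1 *: ((G - P) *m F + F^T *m (G - P)^T).

Definition closed_G G S N F : 'M[K]_(n, m) :=
  G + 2^-1 *: (F^T *m (S + N)^T).

Definition closed_P P S N F : 'M[K]_(n, m) :=
  P + 2^-1 *: (F^T *m (S + N)^T).

End Feedback.

Definition regular_pencil (K : fieldType) (n : nat) (E A : 'M[K]_n) : Prop :=
  \det ('X *: map_mx polyC E - map_mx polyC A) != 0.

Definition finite_eigenvalue (K : realType) (n : nat) (E A : 'M[K]_n)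
    (lam : K[i]) : Prop :=
  \det (lam *: complexify E - complexify A) = 0.

Definition jordan_block (F : fieldType) (a : F) (p : nat) : 'M[F]_p :=
  \matrix_(i, j) (a *+ (i == j) + (i.+1 == j :> nat)%:R).

(* U (s E - A) V = diag (s I - J_fin, s J_inf - I), where J_fin has k Jordan
   blocks of sizes q i for the finite eigenvalues lam i, and J_inf has l
   nilpotent Jordan blocks of sizes p j, the blocks at infinity. The equation e
   only reconciles the sum of the block sizes with n. *)
Definition weierstrass_form (F : fieldType) (n : nat) (E A : 'M[F]_n)
    (k l : nat) (q : 'I_k -> nat) (lam : 'I_k -> F) (p : 'I_l -> nat) : Prop :=
  [/\ forall i, (0 < q i)%N, forall j, (0 < p j)%N
    & exists (e : (\sum_i q i + \sum_j p j)%N = n) (U V : 'M[F]_n),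
      [/\ U \in unitmx, V \in unitmx,
          U *m E *m V =
            castmx (e, e)
              (block_mx 1%:M 0 0 (\mxdiag_j jordan_block 0 (p j)))
        & U *m A *m V =
            castmx (e, e)
              (block_mx (\mxdiag_i jordan_block (lam i) (q i)) 0 0 1%:M)]].

(* The canonical form is taken over the complex numbers, and is unique up to
   the order of the blocks. Without blocks at infinity, that is for E
   nonsingular, the maximum is over an empty family, hence 0. *)
Definition pencil_index (K : realType) (n : nat) (E A : 'M[K]_n) (nu : nat)
    : Prop :=
  exists (k l : nat) (q : 'I_k -> nat) (lam : 'I_k -> K[i]) (p : 'I_l -> nat),
    weierstrass_form (complexify E) (complexify A) q lam p
    /\ nu = (\max_j p j)%N.

(* Main.v *)
(* Write A = J - R, B = G - P, D = S + N. If the closed-loop dissipation matrix is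
   positive semidefinite, its kernel on vectors (0, u) with S u = 0 gives
   range (D F) <= range S, so F = D^(+) R(S) F1 + S_oo(D) F2; hence a left vector
   annihilated by B D^(+) R(S) and B S_oo(D) does not see the feedback, and both
   rank conditions follow. Conversely, with X = B D^(+) and Z = S_oo(D), take
   F = - 2 D^(+) (S X^T + P^T) - Z (B Z)^T. The closed loop is port-Hamiltonian,
   and x^T R' x = 0 forces x^T to annihilate X R(S), B Z and B F. For Re s >= 0 a
   left null vector v of s E - A' has v^* R' v = 0, hence is a left null vector of
   s E - A (or of A and E), and the first rank condition gives v = 0. In the same
   way the second one gives that no nonzero left null vector of E annihilates
   A' ker E, which is index at most one. *)

Require Import Defs.
From mathcomp Require Import all_boot all_order all_algebra.
From mathcomp Require Import complex reals.
From mathcomp Require Import ring.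

Set Implicit Arguments.
Unset Strict Implicit.
Unset Printing Implicit Defensive.

Import Order.TTheory GRing.Theory Num.Theory.

Local Open Scope ring_scope.

(** * Jordan form *)

(** Each strict drop lowers the rank by at least one, so without a repetition
    [\rank (A ^+ p) + p <= n] would hold for all [p], which is absurd at [p = n.+1]. *)
Lemma rank_expmx_stable (F : fieldType) n (A : 'M[F]_n) :
  exists p, \rank (A ^+ p.+1) == \rank (A ^+ p).
Proof.
have mono p : (\rank (A ^+ p.+1) <= \rank (A ^+ p))%N.
  by rewrite exprSr mxrankM_maxl.
have H p : (exists p, \rank (A ^+ p.+1) == \rank (A ^+ p))
    \/ (\rank (A ^+ p) + p <= n)%N.
  elim: p => [|p [|IH]]; [by right; rewrite addn0 rank_leq_row | by left |].
  have := mono p; rewrite leq_eqVlt => /orP[e|lt]; first by left; exists p.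
  by right; rewrite addnS -addSn (leq_trans _ IH) // leq_add2r.
have [//|] := H n.+1.
by rewrite leqNgt ltn_addl.
Qed.

Lemma kermx_expS_stable (F : fieldType) n m (A : 'M[F]_n) p (y : 'M_(m, n)) :
  \rank (A ^+ p.+1) = \rank (A ^+ p) -> y *m A ^+ p.+1 = 0 -> y *m A ^+ p = 0.
Proof.
move=> rA /sub_kermxP yA; apply/sub_kermxP; apply: submx_trans yA _.
have sK : (kermx (A ^+ p) <= kermx (A ^+ p.+1))%MS.
  by apply/sub_kermxP; rewrite exprSr -mulmxE mulmxA mulmx_ker mul0mx.
by have := mxrank_leqif_sup sK; rewrite !mxrank_ker rA => /leqif_refl.
Qed.

(* p.+1 is the exponent at which the kernels of the powers of A become
   stationary, and w is found among the columns of cokermx (A ^+ p.+1): were they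
   all orthogonal to u A^p, then u A^p = y A^(p+1), hence u A^p = 0 by
   stationarity. *)
Lemma nilpotent_chain (F : fieldType) n (A : 'M[F]_n) : A \notin unitmx ->
  exists p (u : 'rV_n) (w : 'cV_n),
    [/\ u *m A ^+ p.+1 = 0, A ^+ p.+1 *m w = 0 & u *m A ^+ p *m w != 0].
Proof.
move=> nA; have exP := rank_expmx_stable A.
case: (ex_minnP exP) => -[|p] /eqP rA pmin.
  by move: nA; rewrite -row_free_unit /row_free -[A]expr1 rA expr0 mxrank1 eqxx.
have nsK : ~~ (kermx (A ^+ p.+1) <= kermx (A ^+ p))%MS.
  apply/negP => /mxrankS; rewrite !mxrank_ker leq_sub2lE ?rank_leq_row // => le.
  suff /pmin : \rank (A ^+ p.+1) == \rank (A ^+ p) by rewrite ltnn.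
  by rewrite eqn_leq le exprSr mxrankM_maxl.
case/row_subPn: nsK => i.
set u := row i _; rewrite sub_kermx => uA.
have uA0 : u *m A ^+ p.+1 = 0 by rewrite -row_mul mulmx_ker row0.
have /matrix0Pn[a [j Haj]] : u *m A ^+ p *m cokermx (A ^+ p.+1) != 0.
  rewrite -submxE; apply: contra uA => /submxP[y yE].
  rewrite yE (kermx_expS_stable rA) //.
  by rewrite exprSr -mulmxE mulmxA -yE -mulmxA mulmxE -exprSr.
exists p, u, (col j (cokermx (A ^+ p.+1))); split=> //.
  by rewrite colE mulmxA mulmx_coker mul0mx.
by apply/matrix0Pn; exists a, 0; rewrite colE mulmxA -colE mxE.
Qed.

(* The rows u A^i and the columns A^(p-j) w have a triangular matrix of
   pairings with a nonzero diagonal, and normalising D by the inverse of that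
   matrix keeps A D = D J because the pairing matrix commutes with J. *)
Lemma jordan_chain (F : fieldType) n (A : 'M[F]_n) : A \notin unitmx ->
  exists p (C : 'M_(p.+1, n)) (D : 'M_(n, p.+1)),
    [/\ C *m A = jordan_block 0 p.+1 *m C, A *m D = D *m jordan_block 0 p.+1
      & C *m D = 1%:M].
Proof.
move=> /nilpotent_chain[p [u [w [uA Aw uAw]]]].
have J0 (i k : 'I_p.+1) : jordan_block (0 : F) p.+1 i k = (i.+1 == k :> nat)%:R.
  by rewrite mxE mul0rn add0r.
have A0 k : (p < k)%N -> A ^+ k = A ^+ p.+1 * A ^+ (k - p.+1).
  by move=> lt; rewrite -exprD subnKC.
pose C := \matrix_(i < p.+1) (u *m A ^+ i).
pose D := \matrix_(i < n, j < p.+1) (A ^+ (p - j) *m w) i 0.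
have CA : C *m A = jordan_block 0 p.+1 *m C.
  apply/row_matrixP => i; rewrite !row_mul rowK [RHS]mulmx_sum_row -mulmxA mulmxE -exprSr.
  case: (ltnP i p) => ip.
    rewrite (bigD1 (Ordinal (ip : i.+1 < p.+1)%N)) //= big1 => [|k].
      by rewrite mxE J0 eqxx scale1r addr0 rowK.
    by rewrite -val_eqE /= mxE J0 eq_sym => /negPf ->; rewrite scale0r.
  have -> : i = p :> nat by apply/eqP; rewrite eqn_leq ip -ltnS ltn_ord.
  rewrite uA big1 // => k _; rewrite mxE J0 gtn_eqF ?scale0r //.
  by rewrite ltnS (leq_trans (leq_ord k)).
have AD : A *m D = D *m jordan_block 0 p.+1.
  have colD j : col j D = A ^+ (p - j) *m w.
    by apply/colP => a; rewrite !mxE.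
  apply/matrixP => a j.
  have -> : (A *m D) a j = (A *m (A ^+ (p - j) *m w)) a 0.
    by rewrite -colD colE mulmxA -colE [RHS]mxE.
  rewrite mulmxA mulmxE -exprS [RHS]mxE; case: j => -[|j] lt.
    rewrite [(p - _)%N]subn0 Aw mxE big1 // => k _.
    by rewrite J0 mulr0.
  rewrite (bigD1 (Ordinal (ltnW lt : j < p.+1)%N)) //= big1 => [|k].
    by rewrite J0 eqxx mulr1 addr0 [RHS]mxE subnSK.
  by rewrite -val_eqE J0 eqSS /= => /negPf ->; rewrite mulr0.
have CDE i j : (C *m D) i j = (u *m A ^+ (i + (p - j)) *m w) 0 0.
  rewrite exprD -mulmxE mulmxA -mulmxA mxE [RHS]mxE.
  by apply: eq_bigr => k _; rewrite !mxE.
have CDu : C *m D \in unitmx.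
  rewrite -unitmx_tr unitmxE det_trig; last first.
    apply/is_trig_mxP => i j ij; rewrite mxE CDE A0; last first.
      by rewrite addnBA 1?leq_ord // ltn_subRL ltn_add2r.
    by rewrite -mulmxE mulmxA uA !mul0mx mxE.
  rewrite unitfE; apply/prodf_neq0 => i _; rewrite mxE CDE subnKC ?leq_ord //.
  apply: contra uAw => /eqP h; apply/eqP/matrixP => a b.
  by rewrite !ord1 h mxE.
exists p, C, (D *m invmx (C *m D)); split => //; last by rewrite mulmxA mulmxV.
have MJ : C *m D *m jordan_block 0 p.+1 = jordan_block 0 p.+1 *m (C *m D).
  by rewrite -mulmxA -AD mulmxA CA mulmxA.
rewrite mulmxA AD -!mulmxA; congr (D *m _); apply: (can_inj (mulKmx CDu)).
by rewrite mulmxA MJ mulmxK // mulKVmx.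
Qed.

(** The idempotent [Q] complementary to [D *m C] is factored through its rank as
    [col_base Q *m row_base Q], which supplies [L] and [K]. Full rank of [Q] would force [D = 0]
    because [Q *m D = 0], hence [l < n]. *)
Lemma projector_split (F : fieldType) n p (C : 'M[F]_(p.+1, n)) (D : 'M_(n, p.+1)) :
  C *m D = 1%:M ->
  exists l (K : 'M_(l, n)) (L : 'M_(n, l)),
    [/\ (l < n)%N, K *m L = 1%:M, C *m L = 0, K *m D = 0 & D *m C + L *m K = 1%:M].
Proof.
move=> CD; pose Q := 1%:M - D *m C.
have QD : Q *m D = 0 by rewrite mulmxBl mul1mx -mulmxA CD mulmx1 subrr.
have CQ : C *m Q = 0 by rewrite mulmxBr mulmx1 mulmxA CD mul1mx subrr.
have QQ : Q *m Q = Q by rewrite {2}/Q mulmxBr mulmx1 mulmxA QD mul0mx subr0.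
have Lf := col_base_full Q; have Kf := row_base_free Q.
exists (\rank Q), (row_base Q), (col_base Q); split.
- rewrite ltn_neqAle rank_leq_row andbT; apply/negP; rewrite -/(row_free Q).
  rewrite row_free_unit => Qu; have D0 : D = 0 by rewrite -(mulKmx Qu D) QD mulmx0.
  move: CD; rewrite D0 mulmx0 => /matrixP/(_ 0 0)/eqP.
  by rewrite !mxE eq_sym oner_eq0.
- apply: (row_full_inj Lf); apply: (row_free_inj Kf).
  by rewrite mulmx1 mulmxA mulmx_base -mulmxA mulmx_base.
- by apply: (row_free_inj Kf); rewrite mul0mx -mulmxA mulmx_base.
- by apply: (row_full_inj Lf); rewrite mulmx0 mulmxA mulmx_base.
- by rewrite mulmx_base addrC subrK.
Qed.

Lemma jordan_blockD (F : fieldType) (a : F) p :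
  jordan_block a p = jordan_block 0 p + a%:M.
Proof. by apply/matrixP => i j; rewrite !mxE mul0rn add0r addrC. Qed.

(** Strong induction on the size: a chain of [A - a%:M], for an eigenvalue [a], splits off as one
    block, and the compression [K *m A *m L] to the complement is smaller. With an arbitrary finite
    index type the new block is added through [option I]. *)
Lemma jordan_decomposition (F : numClosedFieldType) n (A : 'M[F]_n) :
  exists (I : finType) (q : I -> nat) (lam : I -> F)
         (C : forall i, 'M_(q i, n)) (D : forall i, 'M_(n, q i)),
    [/\ forall i, (0 < q i)%N,
        forall i, C i *m A = jordan_block (lam i) (q i) *m C i,
        forall i, C i *m D i = 1%:M,
        forall i j, i != j -> C i *m D j = 0
      & \sum_i D i *m C i = 1%:M].
Proof.
elim/ltn_ind: n A => -[|n] IH A.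
  exists void, (fun=> 0%N), (fun=> 0), (fun=> 0), (fun=> 0).
  by split=> [[]|[]|[]|[]|]; rewrite [LHS]thinmx0 [RHS]thinmx0.
have [a /eigenvalueP[v vA v0]] := eigenvalue_closed A (ltn0Sn n).
have /jordan_chain[p [C0 [D0 [CA AD CD]]]] : A - a%:M \notin unitmx.
  apply: contra v0 => Au; rewrite -(mulmxK Au v) mulmxBr vA mul_mx_scalar subrr.
  by rewrite mul0mx.
have {}CA : C0 *m A = jordan_block a p.+1 *m C0.
  rewrite jordan_blockD mulmxDl -CA mulmxBr mul_mx_scalar mul_scalar_mx.
  by rewrite subrK.
have {}AD : A *m D0 = D0 *m jordan_block a p.+1.
  rewrite jordan_blockD mulmxDr -AD mulmxBl mul_mx_scalar mul_scalar_mx.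
  by rewrite subrK.
have [l [K [L [ln KL CL KD DC]]]] := projector_split CD.
(* The row space of [K] is invariant under [A]: in [K *m A *m (D0 *m C0 + L *m K)] the first term
   vanishes since [A *m D0] factors through [D0] and [K *m D0 = 0]. *)
have KA : K *m A = K *m A *m L *m K.
  rewrite -[LHS]mulmx1 -DC mulmxDr !mulmxA -(mulmxA K) AD !mulmxA KD.
  by rewrite !mul0mx add0r.
have [I [q [lam [C [D [q0 CiA CiD CDj DCs]]]]]] := IH l ln (K *m A *m L).
pose q' o := if o is Some i then q i else p.+1.
exists (option I), q',
  (fun o => if o is Some i then lam i else a),
  (fun o => match o return 'M_(q' o, n.+1) with Some i => C i *m K | None => C0 end),
  (fun o => match o return 'M_(n.+1, q' o) with Some i => L *m D i | None => D0 end).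
split.
- by case.
- case=> [i|] //; rewrite mulmxA -CiA.
  by rewrite -!mulmxA; congr (C i *m _); rewrite KA !mulmxA.
- case=> [i|] //; rewrite -mulmxA (mulmxA K) KL mul1mx; exact: CiD.
- case=> [i|] [j|] //= ij.
  + by rewrite -mulmxA (mulmxA K) KL mul1mx CDj.
  + by rewrite -mulmxA KD mulmx0.
  + by rewrite mulmxA CL mul0mx.
- rewrite (bigD1 None) //= -DC; congr (_ + _).
  rewrite (reindex_omap Some id) => [|[]] //=.
  rewrite -[K in RHS]mul1mx -DCs mulmx_suml mulmx_sumr.
  by apply: eq_big => i; rewrite ?eqxx // !mulmxA.
Qed.

(** * Pencils of index at most one *)

Lemma jordan_form (F : numClosedFieldType) n (A : 'M[F]_n) :
  exists k (q : 'I_k -> nat) (lam : 'I_k -> F)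
         (T : 'M_(\sum_i q i, n)) (T' : 'M_(n, \sum_i q i)),
    [/\ forall i, (0 < q i)%N, T *m T' = 1%:M, T' *m T = 1%:M
      & T *m A = \mxdiag_i jordan_block (lam i) (q i) *m T].
Proof.
have [I [q [lam [C [D [q0 CA CD CDj DC]]]]]] := jordan_decomposition A.
exists #|I|, (fun i => q (enum_val i)), (fun i => lam (enum_val i)),
  (\mxcol_i C (enum_val i)), (\mxrow_i D (enum_val i)); split=> //.
- rewrite mul_mxcol_mxrow -(@mxdiagZ _ _ _ 1); apply: eq_mxblock => i j.
  case: eqVneq => [<-|ij]; first by rewrite conform_mx_id CD.
  by rewrite CDj // (inj_eq enum_val_inj).
- by rewrite mul_mxrow_mxcol -DC [RHS](reindex _ (onW_bij _ (enum_val_bij I))).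
- by rewrite mul_mxdiag_mxcol mxcol_mul; apply: eq_mxcol => i; rewrite CA.
Qed.

(** Once [E] is brought to [pid_mx r], the hypothesis amounts to invertibility of the lower right
    block [B22] of the transformed [A]; block elimination with pivot [B22] then decouples the two
    parts. *)
Lemma index1_block_form (F : fieldType) n (E A : 'M[F]_n) :
    (forall v : 'rV_n, v *m E = 0 ->
       (forall z : 'cV_n, E *m z = 0 -> v *m A *m z = 0) -> v = 0) ->
  exists r l (e : (r + l)%N = n) (U V : 'M_n) (A1 : 'M_r),
    [/\ U \in unitmx, V \in unitmx,
        U *m E *m V = castmx (e, e) (block_mx 1%:M 0 0 0)
      & U *m A *m V = castmx (e, e) (block_mx A1 0 0 1%:M)].
Proof.
have [r [L0 [R0 [rn Lu Ru LER]]]] : exists r (L0 R0 : 'M_n),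
    [/\ (r <= n)%N, L0 \in unitmx, R0 \in unitmx & L0 *m E *m R0 = pid_mx r].
  exists (\rank E), (invmx (col_ebase E)), (invmx (row_ebase E)).
  rewrite rank_leq_row !unitmx_inv col_ebase_unit row_ebase_unit.
  by split=> //; rewrite -[X in _ *m X *m _]mulmx_ebase !mulmxA mulVmx ?col_ebase_unit //
    mul1mx mulmxK ?row_ebase_unit.
have [l e] : exists l, n = (r + l)%N by exists (n - r)%N; rewrite subnKC.
subst n => idx; exists r, l, erefl; move: LER; rewrite pid_mx_block => LER.
pose B := L0 *m A *m R0.
have BE : B = block_mx (ulsubmx B) (ursubmx B) (dlsubmx B) (drsubmx B).
  by rewrite submxK.
set B11 := ulsubmx B in BE; set B12 := ursubmx B in BE.
set B21 := dlsubmx B in BE; set B22 := drsubmx B in BE.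
have B22u : B22 \in unitmx.
  rewrite -row_free_unit -kermx_eq0; apply/rowV0P => w /sub_kermxP wB.
  have vE : row_mx 0 w *m L0 *m E = 0.
    apply: (can_inj (mulmxK Ru)); rewrite mul0mx -!mulmxA (mulmxA L0) LER.
    by rewrite mul_row_block !mulmx0 !mul0mx !addr0 row_mx0.
  have vAz (z : 'cV_(r + l)) : E *m z = 0 -> row_mx 0 w *m L0 *m A *m z = 0.
    move=> Ez.
    have zE : z = R0 *m (invmx R0 *m z) by rewrite mulKVmx.
    move: Ez zE; set y := invmx R0 *m z => Ez zE.
    have : L0 *m E *m R0 *m y = 0 by rewrite -[_ *m y]mulmxA -zE -mulmxA Ez mulmx0.
    rewrite LER -[y]vsubmxK mul_block_col !mul0mx mul1mx !addr0 => y0.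
    have {}y0 : usubmx y = 0 by move: y0 => /(congr1 usubmx); rewrite col_mxKu linear0.
    rewrite zE -!mulmxA (mulmxA L0) (mulmxA (L0 *m A)) -/B BE.
    rewrite mulmxA mul_row_block !mul0mx !add0r wB -[y]vsubmxK y0.
    by rewrite mul_row_col mulmx0 mul0mx addr0.
  have := congr1 (mulmx^~ (invmx L0)) (idx _ vE vAz).
  rewrite /= mulmxK // mul0mx => /(congr1 rsubmx).
  by rewrite row_mxKr linear0.
(* [U] and [V] clear the off-diagonal blocks of [B] and leave the Schur complement of [B22]; both
   preserve the normal form of [E]. *)
pose U := block_mx 1%:M (- (B12 *m invmx B22)) 0 (invmx B22).
pose V := block_mx 1%:M 0 (- (invmx B22 *m B21)) (1%:M : 'M_l).
exists (U *m L0), (R0 *m V), (B11 - B12 *m invmx B22 *m B21); split.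
- rewrite unitmx_mul Lu andbT unitmxE det_ublock det1 mul1r -unitmxE.
  by rewrite unitmx_inv.
- by rewrite unitmx_mul Ru unitmxE det_lblock !det1 mul1r unitr1.
- rewrite castmx_id -!mulmxA (mulmxA E) (mulmxA L0) (mulmxA L0) LER.
  by rewrite !mulmx_block !(mulmx0, mul0mx, mul1mx, mulmx1, addr0, add0r).
- rewrite castmx_id -!mulmxA (mulmxA A) (mulmxA L0) (mulmxA L0) -/B BE.
  rewrite !mulmx_block !(mulmx0, mul0mx, mul1mx, mulmx1, addr0, add0r).
  rewrite [B22 *m _]mulmxN mulKVmx // subrr !mulmx0 addr0 mulVmx //.
  by rewrite mulmxN mulNmx -mulmxA mulVmx // mulmx1 subrr mulmxA.
Qed.

(** Similarity on the finite part. The sizes [s1] and [s2] are kept apart from [r] and [l] because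
    in a Weierstrass form they are sums of block sizes, equal to [r] and [l] only up to a proof. *)
Lemma block_form_conj (F : fieldType) n (E A U V : 'M[F]_n) r l (e : (r + l)%N = n)
    (A1 : 'M_r) s1 s2 (J1 : 'M_s1) (T : 'M_(s1, r)) (T' : 'M_(r, s1)) :
  U \in unitmx -> V \in unitmx ->
  U *m E *m V = castmx (e, e) (block_mx 1%:M 0 0 0) ->
  U *m A *m V = castmx (e, e) (block_mx A1 0 0 1%:M) ->
  T *m T' = 1%:M -> T' *m T = 1%:M -> T *m A1 = J1 *m T -> s2 = l ->
  exists (e' : (s1 + s2)%N = n) (U' V' : 'M_n),
    [/\ U' \in unitmx, V' \in unitmx,
        U' *m E *m V' = castmx (e', e') (block_mx 1%:M 0 0 0)
      & U' *m A *m V' = castmx (e', e') (block_mx J1 0 0 1%:M)].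
Proof.
move=> Uu Vu UE UA TT' T'T TA el.
have es : s1 = r by apply/eqP; rewrite eqn_leq (mulmx1_min TT') (mulmx1_min T'T).
subst r l n; exists erefl; rewrite !castmx_id in UE UA *.
exists (block_mx T 0 0 1%:M *m U), (V *m block_mx T' 0 0 1%:M).
have [Tu T'u] := mulmx1_unit TT'.
split.
- by rewrite unitmx_mul Uu andbT unitmxE det_ublock det1 mulr1 -unitmxE.
- by rewrite unitmx_mul Vu unitmxE det_ublock det1 mulr1 -unitmxE.
- rewrite -!mulmxA (mulmxA E) (mulmxA U) (mulmxA U) UE.
  by rewrite !mulmx_block !(mulmx0, mul0mx, mul1mx, mulmx1, addr0, add0r) TT'.
- rewrite -!mulmxA (mulmxA A) (mulmxA U) (mulmxA U) UA.
  rewrite !mulmx_block !(mulmx0, mul0mx, mul1mx, mulmx1, addr0, add0r).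
  by rewrite mulmxA TA -mulmxA TT' mulmx1.
Qed.

(** The finite part gets its complex Jordan form, and the zero block of [E] counts as [l] Jordan
    blocks of size one at infinity. For [l = 0] the maximum is 0, hence a bound and not an
    equality. *)
Lemma pencil_index_le1 (K : realType) n (E A : 'M[K]_n) :
    (forall v : 'rV_n, v *m E = 0 ->
       (forall z : 'cV_n, E *m z = 0 -> v *m A *m z = 0) -> v = 0) ->
  exists2 nu, pencil_index E A nu & (nu <= 1)%N.
Proof.
move=> /index1_block_form[r [l [e [U [V [A1 [Uu Vu UE UA]]]]]]].
have [k [q [lam [T [T' [q0 TT' T'T TA]]]]]] := jordan_form (complexify A1).
have mxc M : complexify (castmx (e, e) M) = castmx (e, e) (complexify M).
  by rewrite map_castmx.
have El1 : (\sum_(j < l) 1)%N = l by rewrite sum1_card card_ord.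
have := congr1 (fun M => complexify M) UE.
have := congr1 (fun M => complexify M) UA.
rewrite !mxc !map_block_mx !map_mx0 !map_mx1 !map_mxM => UA' UE'.
have [||e' [U' [V' [U'u V'u UE'' UA'']]]] :=
  block_form_conj _ _ UE' UA' TT' T'T TA El1; rewrite ?map_unitmx //.
exists (\max_(j < l) 1)%N; last by apply/bigmax_leqP.
exists k, l, q, lam, (fun=> 1%N); split=> //; split=> //.
exists e', U', V'; split=> //; rewrite UE''.
congr (castmx _ (block_mx _ _ _ _)); rewrite -mxdiag0; apply: eq_mxdiag => j.
by apply/matrixP => a b; rewrite !mxE !ord1 mul0rn addr0.
Qed.

(** Blocks of size one make the nilpotent part zero. In the canonical coordinates [w], the condition
    on [E] kills the finite part of [w], and the condition on [A] kills the rest. *)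
Lemma pencil_index_le1_ker (K : realType) n (E A : 'M[K]_n) nu (v : 'rV[K[i]]_n) :
    pencil_index E A nu -> (nu <= 1)%N -> v *m complexify E = 0 ->
    (forall z : 'cV_n, complexify E *m z = 0 -> v *m complexify A *m z = 0) ->
  v = 0.
Proof.
move=> [k [l [q [lam [p [[_ p0 [e [U [V [Uu Vu UE UA]]]]] ->]]]]]] /bigmax_leqP p1.
have J0 : \mxdiag_j jordan_block (0 : K[i]) (p j) = 0.
  rewrite -mxdiag0; apply: eq_mxdiag => j; apply/matrixP => a b.
  have pj (c : 'I_(p j)) : c = 0 :> nat.
    by apply/eqP; rewrite -leqn0 -ltnS (leq_trans (ltn_ord c)) ?p1.
  by rewrite !mxE mul0rn add0r !pj.
rewrite {}J0 in UE; move: (complexify E) (complexify A) => E' A' in UE UA *.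
clear E A; subst n; rewrite !castmx_id in UE UA => vE vA.
have vU : v = v *m invmx U *m U by rewrite mulmxKV.
rewrite vU -[v *m invmx U]hsubmxK; set w := v *m invmx U.
have wE : w *m (U *m E' *m V) = 0.
  by rewrite !mulmxA -vU vE mul0mx.
have w1 : lsubmx w = 0.
  move: wE; rewrite UE -{1}[w]hsubmxK mul_row_block !mulmx0 mulmx1 !addr0.
  by move=> /(congr1 lsubmx); rewrite row_mxKl linear0.
have w2 : rsubmx w = 0.
  apply: trmx_inj; apply/colP => i.
  (* The last columns of [V] span the kernel of [E']; pairing [v *m A'] with one of them reads off
     an entry of [rsubmx w]. *)
  pose z := V *m col_mx 0 (delta_mx i 0 : 'cV_(\sum_j p j)).
  have /vA : E' *m z = 0.
    apply: (can_inj (mulKmx Uu)); rewrite mulmx0 !mulmxA UE.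
    by rewrite mul_block_col !mul0mx mulmx0 !addr0 col_mx0.
  rewrite vU mulmxA -/w -[w *m U *m A']mulmxA -[w *m _ *m V]mulmxA UA.
  rewrite -{1}[w]hsubmxK mul_row_block w1 !mulmx0 !mul0mx mulmx1 ?add0r ?addr0.
  rewrite mul_row_col mul0mx add0r -colE => /matrixP/(_ 0 0).
  by rewrite !mxE.
by rewrite w1 w2 row_mx0 mul0mx.
Qed.

Lemma rank_rowP (F : fieldType) n p (M : 'M[F]_(n, p)) :
  \rank M = n <-> forall v : 'rV_n, v *m M = 0 -> v = 0.
Proof.
have -> : (\rank M = n) <-> row_free M by split=> /eqP.
rewrite -kermx_eq0; split=> [/eqP k0 v /sub_kermxP|h].
  by rewrite k0 submx0 => /eqP.
by apply/rowV0P => v /sub_kermxP /h.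
Qed.

(** * Positive semidefinite matrices *)

Lemma mul_trmx_eq0 (K : realType) n k (x : 'M[K]_(n, k)) : x^T *m x = 0 -> x = 0.
Proof.
move=> x0; apply/matrixP => i j; rewrite mxE.
have := congr1 (fun M : 'M_k => M j j) x0; rewrite !mxE => s0.
have h a : true -> 0 <= x^T j a * x a j by rewrite mxE -expr2 sqr_ge0.
have /eqP := psumr_eq0P h s0 (i := i) isT.
by rewrite mxE -expr2 sqrf_eq0 => /eqP.
Qed.

Section Psd.
Variable K : realType.

Lemma psdD n (M1 M2 : 'M[K]_n) : psd M1 -> psd M2 -> psd (M1 + M2).
Proof.
move=> [s1 p1] [s2 p2]; split=> [|x]; first by rewrite linearD /= s1 s2.
by rewrite mulmxDr mulmxDl mxE addr_ge0.
Qed.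

Lemma psd_congr n k (M : 'M[K]_n) (T : 'M_(n, k)) : psd M -> psd (T^T *m M *m T).
Proof.
move=> [s p]; split=> [|x]; first by rewrite !trmx_mul trmxK s mulmxA.
by have := p (T *m x); rewrite trmx_mul !mulmxA.
Qed.

Lemma psd1 n : psd (1%:M : 'M[K]_n).
Proof.
split=> [|x]; first exact: trmx1.
by rewrite mulmx1 mxE sumr_ge0 // => i _; rewrite mxE -expr2 sqr_ge0.
Qed.

(** Column by column, with [z = M *m y]: the form at [z + t *: y] is affine in [t] with slope twice
    the squared norm of [z], and an affine function bounded below is constant. *)
Lemma psd_mul0 n k (M : 'M[K]_n) (x : 'M_(n, k)) :
  psd M -> x^T *m M *m x = 0 -> M *m x = 0.
Proof.
move=> [sM pM] x0; have : forall j, M *m col j x = 0; last first.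
  move=> h; apply/matrixP => i j.
  by have /colP/(_ i) := h j; rewrite colE mulmxA -colE !mxE.
move=> j; set y := col j x.
have y0 : y^T *m M *m y = 0.
  rewrite /y colE trmx_mul -!mulmxA (mulmxA x^T) (mulmxA (x^T *m M)) x0.
  by rewrite mul0mx mulmx0.
apply: mul_trmx_eq0; set z := M *m y.
have zE : z^T = y^T *m M by rewrite trmx_mul sM.
have zMy : z^T *m M *m y = z^T *m z by rewrite -mulmxA.
have yMz : y^T *m M *m z = z^T *m z by rewrite zE.
set c := (z^T *m z) 0 0; set q := (z^T *m M *m z) 0 0.
have h t : 0 <= q + t * c *+ 2.
  have := pM (z + t *: y).
  have -> : (z + t *: y)^T = z^T + t *: y^T by rewrite linearD linearZ.
  rewrite !mulmxDl !mulmxDr.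
  rewrite -!scalemxAl -!scalemxAr zMy yMz y0 !scaler0 addr0.
  have tE (X : 'M[K]_1) : (t *: X) 0 0 = t * X 0 0 by rewrite mxE.
  by rewrite mxE [X in X + _]mxE tE -addrA -mulr2n.
have c0 : c = 0.
  (* This [t] gives the affine function the value -1. *)
  apply/eqP; apply/negPn/negP => c0; have := h (- (q + 1) / (c *+ 2)).
  rewrite -mulrnAr divfK; last by rewrite mulrn_eq0.
  by rewrite opprD addrA subrr add0r oppr_ge0 lt_geF ?ltr01.
by apply/matrixP => a b; rewrite !ord1 -/c c0 mxE.
Qed.

Lemma psd_mulD0 n k (M1 M2 : 'M[K]_n) (x : 'M_(n, k)) :
  psd M1 -> psd M2 -> x^T *m (M1 + M2) *m x = 0 -> M1 *m x = 0 /\ M2 *m x = 0.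
Proof.
move=> p1 p2 x0; have col0 j : (M1 *m col j x = 0) /\ (M2 *m col j x = 0).
  set y := col j x.
  have y0 : y^T *m (M1 + M2) *m y = 0.
    rewrite /y colE trmx_mul -!mulmxA (mulmxA x^T) (mulmxA (x^T *m _)) x0.
    by rewrite mul0mx mulmx0.
  have e : (y^T *m M1 *m y) 0 0 + (y^T *m M2 *m y) 0 0 = 0.
    by have /matrixP/(_ 0 0) := y0; rewrite mulmxDr mulmxDl !mxE.
  have [q1 q2] := (p1.2 y, p2.2 y).
  have /andP[/eqP e1 /eqP e2] :
      ((y^T *m M1 *m y) 0 0 == 0) && ((y^T *m M2 *m y) 0 0 == 0).
    by rewrite -paddr_eq0 // e.
  by split; apply: psd_mul0 => //; apply/matrixP => a b; rewrite !ord1 ?e1 ?e2 mxE.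
by split; apply/matrixP => i j; have [/colP/(_ i) h1 /colP/(_ i) h2] := col0 j;
  move: h1 h2; rewrite !colE !mulmxA -!colE !mxE.
Qed.

Section Block.
Variables (n m : nat) (R : 'M[K]_n) (P : 'M[K]_(n, m)) (S : 'M[K]_m).
Hypothesis W_psd : psd (block_mx R P P^T S).

Lemma psd_drblock : psd S.
Proof.
have := psd_congr (col_mx 0 1%:M) W_psd.
rewrite tr_col_mx trmx0 trmx1 mul_row_block !mul0mx !mul1mx !add0r.
by rewrite mul_row_col mulmx0 add0r mulmx1.
Qed.

(** The block form vanishes at [col_mx 0 u], so the whole block matrix kills that vector. *)
Lemma psd_block_ker k (u : 'M_(m, k)) : S *m u = 0 -> P *m u = 0.
Proof.
move=> Su; have := @psd_mul0 _ _ _ (col_mx 0 u) W_psd.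
rewrite tr_col_mx -mulmxA !mul_block_col !mulmx0 !add0r Su.
rewrite mul_row_col trmx0 mul0mx mulmx0 addr0 => /(_ erefl).
by move/(congr1 usubmx); rewrite col_mxKu linear0.
Qed.

End Block.
End Psd.

(** Adding [w *m (S + N) *m w^T] to its transpose cancels [N] and leaves twice [w *m S *m w^T],
    which therefore vanishes. *)
Lemma skew_add_ker (K : realType) m k (S N : 'M[K]_m) (w : 'M_(k, m)) :
  psd S -> N^T = - N -> w *m (S + N) = 0 -> w *m S = 0.
Proof.
move=> pS sN wD; have /(congr1 (mulmx^~ w^T)) := wD; rewrite /= mul0mx => wDw.
have wSw : w *m S *m w^T = 0.
  have wDTw : w *m (S + N)^T *m w^T = 0.
    by rewrite -mulmxA -trmx_mul wD trmx0 mulmx0.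
  have : w *m (S + N) *m w^T + w *m (S + N)^T *m w^T = 0 by rewrite wDw wDTw addr0.
  rewrite -mulmxDl -mulmxDr [(S + N)^T]linearD /= sN pS.1 addrACA subrr addr0 -mulr2n.
  rewrite -scaler_nat -scalemxAr -scalemxAl => /eqP.
  by rewrite scaler_eq0 pnatr_eq0 => /eqP.
apply: trmx_inj; rewrite trmx_mul trmx0 pS.1; apply: psd_mul0 => //.
by rewrite trmxK.
Qed.

(** At [(x, u)] the form is a sum of three nonnegative ones: the given form at [(x, X^T x)], the
    [S]-form at [X^T x - u], and the squared norm of [Y^T x]. *)
Lemma psd_feedback (K : realType) n m k (R : 'M[K]_n) (P X : 'M_(n, m)) (S : 'M_m)
    (Y : 'M_(n, k)) : psd (block_mx R P P^T S) ->
  psd (block_mx (R + P *m X^T + X *m P^T + (X *m S *m X^T) *+ 2 + Y *m Y^T)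
         (- (X *m S)) (- (X *m S))^T S).
Proof.
move=> pW; have pS := psd_drblock pW.
have -> : block_mx (R + P *m X^T + X *m P^T + (X *m S *m X^T) *+ 2 + Y *m Y^T)
         (- (X *m S)) (- (X *m S))^T S =
    (block_mx 1%:M 0 X^T 0)^T *m block_mx R P P^T S *m block_mx 1%:M 0 X^T 0 +
    (row_mx X^T (- 1%:M))^T *m S *m row_mx X^T (- 1%:M) +
    (row_mx Y^T (0 : 'M_(k, m)))^T *m 1%:M *m row_mx Y^T 0.
  rewrite mulmx1 !tr_row_mx !tr_block_mx !mulmx_block !mul_col_mx !mul_mx_row.
  rewrite ![(- _)^T]linearN /= !trmx1 !trmx0 !trmxK.
  rewrite /block_mx !add_col_mx !add_row_mx.
  rewrite !(mulmx0, mul0mx, mul1mx, mulmx1, addr0, add0r).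
  rewrite !(mulNmx, mulmxN, mul1mx, mulmx1, opprK) trmx_mul pS.1.
  congr (col_mx (row_mx _ _) _).
  rewrite mulmxDl mulr2n !addrA; congr (_ + _ + _ + _).
  exact: addrAC.
by apply: psdD; [apply: psdD|]; apply: psd_congr => //; apply: psd1.
Qed.

(** The same decomposition at [u = 0]: each nonnegative term vanishes separately. *)
Lemma psd_feedback_ker (K : realType) n m k l (R : 'M[K]_n) (P X : 'M_(n, m))
    (S : 'M_m) (Y : 'M_(n, k)) (x : 'M_(n, l)) : psd (block_mx R P P^T S) ->
  x^T *m (R + P *m X^T + X *m P^T + (X *m S *m X^T) *+ 2 + Y *m Y^T) *m x = 0 ->
  S *m (X^T *m x) = 0 /\ Y^T *m x = 0.
Proof.
move=> pW; have pS := psd_drblock pW.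
have -> : R + P *m X^T + X *m P^T + (X *m S *m X^T) *+ 2 + Y *m Y^T =
    ((col_mx 1%:M X^T)^T *m block_mx R P P^T S *m col_mx 1%:M X^T) +
    (X *m S *m X^T + Y *m Y^T).
  rewrite tr_col_mx trmx1 trmxK mul_row_block !mul1mx mul_row_col mulmx1.
  rewrite mulmxDl mulr2n !addrA; congr (_ + _ + _ + _).
  exact: addrAC.
have pX : psd (X *m S *m X^T) by rewrite -{1}[X]trmxK; apply: psd_congr.
have pY : psd (Y *m Y^T).
  by rewrite -{1}[Y]trmxK -[Y^T^T]mulmx1; apply/psd_congr/psd1.
move=> /psd_mulD0[||_]; [exact: psd_congr | exact: psdD |].
rewrite mulmxDl => XY0.
have : x^T *m (X *m S *m X^T + Y *m Y^T) *m x = 0.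
  by rewrite -mulmxA mulmxDl XY0 mulmx0.
case/psd_mulD0 => // X0 Y0; split.
  apply: psd_mul0 => //; rewrite trmx_mul trmxK !mulmxA.
  by rewrite -!mulmxA (mulmxA X S) (mulmxA _ X^T) X0 mulmx0.
apply: mul_trmx_eq0; rewrite trmx_mul trmxK !mulmxA.
by rewrite -!mulmxA (mulmxA Y) Y0 mulmx0.
Qed.

(** * Left null vectors of dissipative pencils *)

Lemma skew_quad (K : realType) n (J : 'M[K]_n) (a : 'rV_n) :
  J^T = - J -> a *m J *m a^T = 0.
Proof.
move=> sJ; have : (a *m J *m a^T)^T = - (a *m J *m a^T).
  by rewrite !trmx_mul trmxK sJ mulNmx mulmxN mulmxA.
move=> /matrixP h; apply/matrixP => i j; have := h i j.
rewrite !ord1 !mxE => /eqP; rewrite -addr_eq0 -mulr2n mulrn_eq0 /=.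
by move=> /eqP.
Qed.

(** Here [a] and [b] stand for the real and imaginary parts of a left null vector at [s + i t].
    Pairing the equations with [a^T] and [b^T] and adding, [J] drops out by skewness and the [t]
    terms cancel by symmetry of [E]; a vanishing sum of nonnegative terms remains. *)
Lemma dissipative_left_ker (K : realType) n (E J R : 'M[K]_n) (a b : 'rV_n) (s t : K) :
    psd E -> J^T = - J -> psd R -> 0 <= s ->
    a *m (s *: E - (J - R)) = t *: (b *m E) ->
    b *m (s *: E - (J - R)) = - t *: (a *m E) ->
  [/\ a *m R *m a^T = 0, b *m R *m b^T = 0
    & 0 < s -> a *m E = 0 /\ b *m E = 0].
Proof.
move=> pE sJ pR s0 ha hb.
have quad (M : 'M[K]_n) (x : 'rV_n) : psd M -> 0 <= (x *m M *m x^T) 0 0.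
  by move=> [_ p]; rewrite -{1}[x]trmxK.
have quad0 (M : 'M[K]_n) (x : 'rV_n) :
    (x *m M *m x^T) 0 0 = 0 -> x *m M *m x^T = 0.
  by move=> h; apply/matrixP => i j; rewrite !ord1 h mxE.
have ea := congr1 (fun M => M *m a^T) ha.
have eb := congr1 (fun M => M *m b^T) hb.
have cross : a *m E *m b^T = b *m E *m a^T.
  have -> : b *m E *m a^T = (a *m E *m b^T)^T.
    by rewrite !trmx_mul trmxK pE.1 mulmxA.
  by apply/matrixP => i j; rewrite !ord1 [RHS]mxE.
have sum0 : s * (a *m E *m a^T) 0 0 + s * (b *m E *m b^T) 0 0 +
    ((a *m R *m a^T) 0 0 + (b *m R *m b^T) 0 0) = 0.
  have := congr1 (fun M : 'M_1 => M 0 0) (congr2 +%R ea eb).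
  rewrite !mulmxBr !mulmxBl !(skew_quad _ sJ) !sub0r !opprK.
  rewrite -!scalemxAr -!scalemxAl -cross scaleNr subrr.
  have sE (X : 'M[K]_1) : (s *: X) 0 0 = s * X 0 0 by rewrite mxE.
  have dE (X Y : 'M[K]_1) : (X + Y) 0 0 = X 0 0 + Y 0 0 by rewrite mxE.
  by rewrite !dE !sE addrACA [X in _ = X]mxE.
have [Ea Eb Ra Rb] := And4 (quad _ a pE) (quad _ b pE) (quad _ a pR) (quad _ b pR).
move: sum0 => /eqP; rewrite paddr_eq0 ?addr_ge0 ?mulr_ge0 //.
rewrite !paddr_eq0 ?mulr_ge0 // !mulf_eq0 => /andP[/andP[ha0 hb0] /andP[/eqP ra /eqP rb]].
split; [exact: quad0|exact: quad0|move=> sp].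
have ker (x : 'rV_n) : (s == 0) || ((x *m E *m x^T) 0 0 == 0) -> x *m E = 0.
  rewrite gt_eqF //= => /eqP /quad0 xE; apply: trmx_inj.
  by rewrite trmx_mul trmx0 pE.1; apply: psd_mul0 => //; rewrite trmxK.
by split; apply: ker.
Qed.

(** * Complex row vectors against real matrices *)

Section ComplexRows.
Variable K : realType.
Local Notation ReM := (map_mx (@complex.Re K)).
Local Notation ImM := (map_mx (@complex.Im K)).

Lemma map_Re_mulmx n p (v : 'rV[K[i]]_n) (M : 'M_(n, p)) :
  ReM (v *m complexify M) = ReM v *m M.
Proof.
apply/matrixP => a j; rewrite !mxE.
rewrite (big_morph (@complex.Re K) (id1 := 0) (op1 := +%R)) //; last by case=> ? ? [].
by apply: eq_bigr => k _; rewrite !mxE; case: (v a k) => x y /=; rewrite mulr0 subr0.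
Qed.

Lemma map_Im_mulmx n p (v : 'rV[K[i]]_n) (M : 'M_(n, p)) :
  ImM (v *m complexify M) = ImM v *m M.
Proof.
apply/matrixP => a j; rewrite !mxE.
rewrite (big_morph (@complex.Im K) (id1 := 0) (op1 := +%R)) //; last by case=> ? ? [].
by apply: eq_bigr => k _; rewrite !mxE; case: (v a k) => x y /=; rewrite mulr0 add0r.
Qed.

Lemma complex_row_eq n (v w : 'rV[K[i]]_n) : ReM v = ReM w -> ImM v = ImM w -> v = w.
Proof.
move=> /matrixP hR /matrixP hI; apply/matrixP => a j; apply/eqP.
have := hR a j; have := hI a j; rewrite !mxE => eI eR.
by rewrite eq_complex eI eR !eqxx.
Qed.

Lemma mul_complexify_eq0 n p (v : 'rV[K[i]]_n) (M : 'M_(n, p)) :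
  v *m complexify M = 0 <-> ReM v *m M = 0 /\ ImM v *m M = 0.
Proof.
rewrite -map_Re_mulmx -map_Im_mulmx; split=> [->|[hR hI]].
  by split; apply/matrixP => a j; rewrite !mxE.
by apply: complex_row_eq; rewrite ?hR ?hI; apply/matrixP => a j; rewrite !mxE.
Qed.

Lemma complex_pencil_row n (v : 'rV[K[i]]_n) (s : K[i]) (E A : 'M_n) :
    v *m (s *: complexify E - complexify A) = 0 ->
  ReM v *m (complex.Re s *: E - A) = complex.Im s *: (ImM v *m E) /\
  ImM v *m (complex.Re s *: E - A) = - complex.Im s *: (ReM v *m E).
Proof.
rewrite mulmxBr => /subr0_eq; rewrite -scalemxAr => h.
have hR := congr1 ReM h; have hI := congr1 ImM h.
rewrite map_Re_mulmx in hR; rewrite map_Im_mulmx in hI.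
rewrite !mulmxBr -hR -hI -!scalemxAr -!map_Re_mulmx -!map_Im_mulmx.
move: (v *m complexify E) => w; split; apply/matrixP => a j; rewrite !mxE.
  by case: s (w a j) {h hR hI} => [s1 s2] [x1 x2] /=; rewrite opprB addrC subrK.
case: s (w a j) {h hR hI} => [s1 s2] [x1 x2] /=.
by rewrite opprD addrA subrr add0r mulNr.
Qed.
End ComplexRows.

Lemma regular_pencil_eval (F : fieldType) n (E A : 'M[F]_n) s :
  \det (s *: E - A) != 0 -> regular_pencil E A.
Proof.
apply: contra => /eqP d0.
have -> : s *: E - A = map_mx (horner_eval s) ('X *: map_mx polyC E - map_mx polyC A).
  by apply/matrixP => i j; rewrite !mxE /horner_eval !hornerE.
by rewrite det_map_mx d0 rmorph0.
Qed.

(** * State feedback *)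

Lemma orthonormal_null_basis0 (K : realType) p q k (M : 'M[K]_(p, q)) (Z : 'M_(q, k)) :
  orthonormal_null_basis M Z -> M *m Z = 0.
Proof.
by case=> _ /andP[/sub_kermxP h _]; apply: trmx_inj; rewrite trmx_mul h trmx0.
Qed.

Lemma orthonormal_null_basisP (K : realType) p q k l (M : 'M[K]_(p, q)) (Z : 'M_(q, k))
    (H : 'M_(q, l)) :
  orthonormal_null_basis M Z -> M *m H = 0 -> exists Y, H = Z *m Y.
Proof.
case=> _ /andP[_ sZ] MH; have /sub_kermxP hK : H^T *m M^T = 0.
  by rewrite -trmx_mul MH trmx0.
have /submxP[Y e] := submx_trans hK sZ.
by exists Y^T; rewrite -[H]trmxK e trmx_mul trmxK.
Qed.

Lemma orthonormal_range_basisP (K : realType) p q k (M : 'M[K]_(p, q)) (Q : 'M_(p, k)) :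
  orthonormal_range_basis M Q -> (exists Y, Q = M *m Y) /\ (exists Y, M = Q *m Y).
Proof.
case=> _ /andP[/submxP[Y1 e1] /submxP[Y2 e2]].
split; [exists Y1^T | exists Y2^T].
  by rewrite -[Q]trmxK e1 trmx_mul trmxK.
by rewrite -[M]trmxK e2 trmx_mul trmxK.
Qed.

Section ClosedLoop.
Variables (K : realType) (n m : nat) (E J R : 'M[K]_n) (G P : 'M[K]_(n, m))
  (S N SNp : 'M[K]_m).
Hypothesis hpH : port_hamiltonian E J R G P S N.
Hypothesis hSNp : moore_penrose (S + N) SNp.
Local Notation B := (G - P).
Local Notation D := (S + N).

Lemma closed_JR F : closed_J J G P F - closed_R R G P F = J - R + B *m F.
Proof.
rewrite /closed_J /closed_R opprB [_ - R]addrC addrACA; congr (_ + _).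
rewrite -scalerDr addrACA addNr addr0 -mulr2n -scaler_nat scalerA.
by rewrite mulVf ?pnatr_eq0 // scale1r.
Qed.

Lemma closed_J_skew F : (closed_J J G P F)^T = - closed_J J G P F.
Proof.
have [_ _ _ hJ _] := hpH.
have sJ : J^T = - J.
  move: hJ; rewrite tr_block_mx opp_block_mx => /eq_block_mx[e _ _ _].
  by rewrite {2}e opprK.
rewrite /closed_J -trmx_mul; apply/matrixP => i j; have /matrixP/(_ i j) := sJ.
by rewrite !mxE => ->; rewrite opprD -mulrN opprB.
Qed.

Lemma port_hamiltonian_closed F :
  psd (block_mx (closed_R R G P F) (closed_P P S N F) (closed_P P S N F)^T S) <->
  port_hamiltonian E (closed_J J G P F) (closed_R R G P F) (closed_G G S N F)
    (closed_P P S N F) S N.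
Proof.
have [sS sN pE hJ _] := hpH; split=> [pW|[]//]; split=> //.
rewrite tr_block_mx opp_block_mx closed_J_skew [(- _^T)^T]linearN /= trmxK !opprK.
by rewrite -sN.
Qed.

Let pW : psd (block_mx R P P^T S). Proof. by case: hpH. Qed.
Let sN : N^T = - N. Proof. by have [_ e _ _ _] := hpH; rewrite {2}e opprK. Qed.

(** [1%:M - D *m SNp] annihilates [D] from the left, hence also its symmetric part [S]. *)
Lemma DSNp_S : D *m SNp *m S = S.
Proof.
have [DXD _ _ _] := hSNp.
have := @skew_add_ker _ _ _ S N (1%:M - D *m SNp) (psd_drblock pW) sN.
rewrite mulmxBl mul1mx DXD subrr => /(_ erefl)/eqP.
by rewrite mulmxBl mul1mx subr_eq0 => /eqP.
Qed.

Lemma S_DSNp : S *m (D *m SNp) = S.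
Proof.
have [_ _ sD _] := hSNp; apply: trmx_inj.
by rewrite trmx_mul sD (psd_drblock pW).1 DSNp_S.
Qed.

(** The columns of [1%:M - D *m SNp] lie in the kernel of [S], on which [P] vanishes. *)
Lemma P_DSNp : P *m (D *m SNp) = P.
Proof.
apply/eqP; rewrite -subr_eq0 -[X in _ - X]mulmx1 -mulmxBr; apply/eqP.
by apply: (psd_block_ker pW); rewrite mulmxBr mulmx1 S_DSNp subrr.
Qed.

Lemma feedback_range rS (RS : 'M_(m, rS)) kD (ZD : 'M_(m, kD)) F :
    orthonormal_range_basis S RS -> orthonormal_null_basis D ZD ->
    psd (block_mx (closed_R R G P F) (closed_P P S N F) (closed_P P S N F)^T S) ->
  exists F1 F2, F = SNp *m RS *m F1 + ZD *m F2.
Proof.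
move=> hRS hZD pW'; have [_ [Y2 SE]] := orthonormal_range_basisP hRS.
(* The columns of [cokermx S] span the kernel of [S]. Both [P] and the closed-loop [P] vanish there,
   hence so does [(D *m F)^T], which puts the range of [D *m F] inside that of [S]. *)
have SU := mulmx_coker S.
have := psd_block_ker pW' SU.
rewrite /closed_P mulmxDl (psd_block_ker pW SU) add0r -scalemxAl => /eqP.
rewrite scaler_eq0 invr_eq0 pnatr_eq0 /= -trmx_mul -submxE => /submxP[Y DFE].
have {}DFE : D *m F = RS *m (Y2 *m Y^T).
  by rewrite -[LHS]trmxK DFE trmx_mul (psd_drblock pW).1 {1}SE mulmxA.
have [DXD _ _ _] := hSNp.
have [F2 F2E] : exists F2, F - SNp *m (D *m F) = ZD *m F2.
  apply: orthonormal_null_basisP hZD _.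
  by rewrite mulmxBr !mulmxA DXD subrr.
exists (Y2 *m Y^T), F2; rewrite -F2E DFE !mulmxA.
by rewrite addrC subrK.
Qed.

(** * An explicit stabilizing feedback *)

Section Stabilizing.
Variables (kD : nat) (ZD : 'M[K]_(m, kD)).
Hypothesis hZD : orthonormal_null_basis D ZD.
Local Notation X := (B *m SNp).
Local Notation B2 := (B *m ZD).

(* With X = (G - P) (S + N)^(+) this choice makes the closed-loop P equal to
   - X S, so that the closed-loop dissipation form at (x, u) is the original one at
   (x, X^T x), plus the S-form of X^T x - u, plus the square of
   ZD^T (G - P)^T x. *)
Definition stabilizing_feedback : 'M[K]_(m, n) :=
  - (2 *: (SNp *m (S *m X^T + P^T)) + ZD *m B2^T).
Local Notation F0 := stabilizing_feedback.

Lemma mul_stabilizing_feedback :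
  B *m F0 = - (2 *: (X *m S *m X^T + X *m P^T) + B2 *m B2^T).
Proof.
rewrite /stabilizing_feedback mulmxN [B *m (_ + _)]mulmxDr.
by rewrite -scalemxAr !mulmxA mulmxDr !mulmxA.
Qed.

Lemma half2 (V : lmodType K) (x : V) : 2^-1 *: (2 *: x) = x.
Proof. by rewrite scalerA mulVf ?scale1r ?pnatr_eq0. Qed.

(** [D] kills the [ZD] term, and [D *m SNp] is symmetric and fixes [S] and [P] from the right, so
    half of [(D *m F0)^T] is [- (X *m S + P)]; the factor 2 in the feedback is there for this. *)
Lemma closed_P_stabilizing : closed_P P S N F0 = - (X *m S).
Proof.
have [_ _ sD _] := hSNp.
rewrite /closed_P /stabilizing_feedback -trmx_mul mulmxN.
rewrite [D *m (_ + _)]mulmxDr -scalemxAr !mulmxA.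
rewrite (orthonormal_null_basis0 hZD) mul0mx addr0 linearN linearZ /= trmx_mul sD.
rewrite linearD /= trmx_mul !trmxK (psd_drblock pW).1 mulmxDl -mulmxA S_DSNp P_DSNp.
by rewrite scalerN half2 opprD addrCA subrr addr0.
Qed.

Lemma closed_R_stabilizing : closed_R R G P F0 =
  R + P *m X^T + X *m P^T + (X *m S *m X^T) *+ 2 + B2 *m B2^T.
Proof.
rewrite /closed_R -trmx_mul mul_stabilizing_feedback.
set Q := X *m S *m X^T; have sQ : Q^T = Q.
  by rewrite trmx_mul trmxK [(_ *m S)^T]trmx_mul (psd_drblock pW).1 mulmxA.
set Z := B2 *m B2^T; have sZ : Z^T = Z by rewrite trmx_mul trmxK.
have <- : (X *m P^T)^T = P *m X^T by rewrite trmx_mul trmxK.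
move: (X *m P^T) Q Z sQ sZ => T Q Z /matrixP sQ /matrixP sZ.
apply/matrixP => i j; have := sQ i j; have := sZ i j; rewrite !mxE => -> ->.
by field.
Qed.

Lemma stabilizing_port_hamiltonian :
  port_hamiltonian E (closed_J J G P F0) (closed_R R G P F0) (closed_G G S N F0)
    (closed_P P S N F0) S N.
Proof.
apply/port_hamiltonian_closed; rewrite closed_R_stabilizing closed_P_stabilizing.
exact: psd_feedback.
Qed.

Lemma closed_R_psd : psd (closed_R R G P F0).
Proof.
have [_ _ _ _] := stabilizing_port_hamiltonian.
move/(psd_congr (col_mx 1%:M 0)).
rewrite tr_col_mx trmx0 trmx1 mul_row_block !mul0mx !mul1mx !addr0.
by rewrite mul_row_col mulmx0 addr0 mulmx1.
Qed.

(** Each term of [B *m F0] starts with [X *m S], [X *m P^T] or [B2], and [a] annihilates all three;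
    the second follows from the first because [P] vanishes on the kernel of [S]. *)
Lemma closed_R_ker rS (RS : 'M_(m, rS)) (a : 'rV_n) :
    orthonormal_range_basis S RS -> a *m closed_R R G P F0 *m a^T = 0 ->
  [/\ a *m (X *m RS) = 0, a *m B2 = 0 & a *m (B *m F0) = 0].
Proof.
move=> /orthonormal_range_basisP[[Y RSE] _]; rewrite closed_R_stabilizing => aRa.
have [Sa Ya] : S *m (X^T *m a^T) = 0 /\ B2^T *m a^T = 0.
  by apply: psd_feedback_ker pW _; rewrite trmxK.
have Pa : a *m (X *m P^T) = 0.
  apply: trmx_inj; rewrite !trmx_mul trmxK -mulmxA trmx0 -trmx_mul.
  exact: psd_block_ker pW _ _ Sa.
have aS : a *m (X *m S) = 0.
  apply: trmx_inj; rewrite trmx_mul trmx0 [(X *m S)^T]trmx_mul.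
  by rewrite (psd_drblock pW).1 -mulmxA.
have aB2 : a *m B2 = 0 by apply: trmx_inj; rewrite trmx_mul trmx0.
split=> //; first by rewrite RSE !mulmxA -(mulmxA a) -[a *m _ *m S]mulmxA aS mul0mx.
rewrite mul_stabilizing_feedback mulmxN mulmxDr -scalemxAr mulmxDr Pa.
rewrite [a *m (B2 *m _)]mulmxA aB2 mul0mx [a *m (_ *m X^T)]mulmxA aS mul0mx.
by rewrite !addr0 scaler0 oppr0.
Qed.

End Stabilizing.
End ClosedLoop.

(** * Equivalence of feedback stabilizability and the rank conditions *)

Theorem theorem5 (K : realType) (n m : nat) (E J R : 'M[K]_n)
    (G P : 'M[K]_(n, m)) (S N : 'M[K]_m)
    (hpH : port_hamiltonian E J R G P S N)
    (SNp : 'M[K]_m) (hSNp : moore_penrose (S + N) SNp)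
    (rS : nat) (RS : 'M[K]_(m, rS)) (hRS : orthonormal_range_basis S RS)
    (kE : nat) (ZE : 'M[K]_(n, kE)) (hZE : orthonormal_null_basis E ZE)
    (kD : nat) (ZD : 'M[K]_(m, kD)) (hZD : orthonormal_null_basis (S + N) ZD) :
  (exists F : 'M[K]_(m, n),
     let J' := closed_J J G P F in
     let R' := closed_R R G P F in
     let G' := closed_G G S N F in
     let P' := closed_P P S N F in
     [/\ port_hamiltonian E J' R' G' P' S N,
         regular_pencil E (J' - R'),
         exists2 nu : nat, pencil_index E (J' - R') nu & (nu <= 1)%N
       & forall lam : K[i],
           finite_eigenvalue E (J' - R') lam -> complex.Re lam < 0])
  <->
  ((forall s : K[i], complex.Re s = 0 ->
      \rank (row_mx (s *: complexify E - complexify (J - R))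
              (row_mx (complexify ((G - P) *m SNp *m RS))
                      (complexify ((G - P) *m ZD)))) = n)
   /\
   \rank (row_mx E
           (row_mx ((J - R) *m ZE)
             (row_mx ((G - P) *m SNp *m RS) ((G - P) *m ZD)))) = n).
Proof.
have row0 (F : fieldType) p1 p2 p3
    (M1 : 'M[F]_(n, p1)) (M2 : 'M_(n, p2)) (M3 : 'M_(n, p3)) :
    \rank (row_mx M1 (row_mx M2 M3)) = n <->
    forall v : 'rV_n, v *m M1 = 0 -> v *m M2 = 0 -> v *m M3 = 0 -> v = 0.
  rewrite rank_rowP; split=> h v.
    by move=> v1 v2 v3; apply: h; rewrite !mul_mx_row v1 v2 v3 !row_mx0.
  rewrite !mul_mx_row => /eqP; rewrite !row_mx_eq0 => /and3P[/eqP v1 /eqP v2 /eqP v3].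
  exact: h.
have [_ _ pE _ _] := hpH; set B := G - P in row0 *.
split=> [[F] /= [hF _ [nu hnu nu1] stab]|[]].
  have [_ _ _ _ pW'] := hF.
  have [F1 [F2 FE]] := feedback_range hpH hSNp hRS hZD pW'.
  have A'E : closed_J J G P F - closed_R R G P F =
      J - R + (B *m SNp *m RS *m F1 + B *m ZD *m F2).
    by rewrite closed_JR FE mulmxDr !mulmxA.
  rewrite {}A'E in stab hnu.
  split=> [s s0|]; apply/row0 => v v1 v2 v3.
    (* A nonzero [v] would be a left null vector of the closed-loop pencil too, making the imaginary
       [s] a finite eigenvalue. *)
    apply/eqP/negPn/negP => v0.
    suff /stab : finite_eigenvalue E
        (J - R + (B *m SNp *m RS *m F1 + B *m ZD *m F2)) s by rewrite s0 ltxx.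
    apply/eqP/det0P; exists v => //.
    rewrite map_mxD opprD addrA mulmxDr v1 add0r mulmxN map_mxD !map_mxM.
    move: v2 v3; rewrite !map_mxM !mulmxA => v2 v3.
    by rewrite mulmxDr !mulmxA v2 v3 !mul0mx addr0 oppr0.
  apply/eqP; rewrite -(map_mx_eq0 (real_complex K)); apply/eqP.
  apply: (pencil_index_le1_ker hnu nu1); first by rewrite -map_mxM v1 map_mx0.
  move=> z Ez; have : (complexify ZE)^T *m (complexify E)^T = 0.
    by rewrite -trmx_mul -map_mxM (orthonormal_null_basis0 hZE) map_mx0 trmx0.
  have [_ ZEk] := hZE.
  (* Kernels commute with extension of scalars, so the real basis [ZE] also spans the complex kernel
     of [E]. *)
  have /submxP[Y zE] : (z^T <= complexify ZE^T)%MS.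
    have /andP[_ kZ] := ZEk; apply: submx_trans (_ : _ <= complexify (kermx E^T))%MS _.
      by rewrite map_kermx; apply/sub_kermxP; rewrite -map_trmx -trmx_mul Ez trmx0.
    by rewrite map_submx.
  move=> _; rewrite -[z]trmxK zE trmx_mul map_trmx trmxK mulmxA -!map_mxM.
  rewrite mulmxDr mulmxDl -[v *m _ *m ZE]mulmxA v2 mulmxDr.
  move: v3; rewrite mul_mx_row => /eqP; rewrite row_mx_eq0 => /andP[/eqP v3 /eqP v4].
  rewrite !mulmxA in v3 v4.
  by rewrite !mulmxA v3 v4 !(mul0mx, addr0) map_mx0 mul0mx.
move=> /(_ _ _)/row0 h1 /row0 h2.
exists (stabilizing_feedback G P S SNp ZD) => /=.
set F := stabilizing_feedback _ _ _ _ _.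
have hcl := stabilizing_port_hamiltonian hpH hSNp hZD; rewrite -/F in hcl.
have sJ := closed_J_skew hpH F.
have pR := closed_R_psd hpH hSNp hZD; rewrite -/F in pR.
have Rker (a : 'rV[K]_n) : a *m closed_R R G P F *m a^T = 0 ->
    [/\ a *m (B *m SNp *m RS) = 0, a *m (B *m ZD) = 0 & a *m (B *m F) = 0].
  exact: (closed_R_ker hpH hRS).
have A'E : closed_J J G P F - closed_R R G P F = J - R + B *m F.
  exact: closed_JR.
(* The closed-loop pencil is nonsingular on the closed right half plane; regularity and stability
   both rest on this. *)
have Cker (s : K[i]) (v : 'rV_n) : 0 <= complex.Re s ->
    v *m (s *: complexify E - complexify (closed_J J G P F - closed_R R G P F)) = 0 ->
  v = 0.
  move=> s0 vs; have [va vb] := complex_pencil_row vs.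
  have [ra rb rE] := dissipative_left_ker pE sJ pR s0 va vb.
  have [a1 a2 a3] := Rker _ ra; have [b1 b2 b3] := Rker _ rb.
  have vA : v *m complexify (closed_J J G P F - closed_R R G P F) =
      v *m complexify (J - R).
    rewrite A'E map_mxD mulmxDr [X in _ + X](_ : _ = 0) ?addr0 //.
    exact/mul_complexify_eq0.
  rewrite mulmxBr vA in vs.
  (* Either [s] is already imaginary, or [v] kills [E], hence also [J - R], and [s' = 0] serves. *)
  have [s' [s'0 vs']] : exists s' : K[i], complex.Re s' = 0 /\
      v *m (s' *: complexify E - complexify (J - R)) = 0.
    move: s0; rewrite le_eqVlt => /orP[/eqP s0|/rE [aE bE]].
      by exists s; rewrite mulmxBr.
    exists 0; split=> //; rewrite scale0r sub0r mulmxN.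
    move: vs; rewrite -scalemxAr (_ : v *m complexify E = 0) ?scaler0 ?sub0r //.
    exact/mul_complexify_eq0.
  by apply: (h1 s' s'0); rewrite ?vs' //; apply/mul_complexify_eq0.
split=> //.
(* The point 0 lies in the closed right half plane, so the determinant is nonzero there. *)
- apply: (@regular_pencil_eval _ _ _ _ 0); apply/det0P => -[v v0 hv].
  case/eqP: v0; apply/eqP; rewrite -(map_mx_eq0 (real_complex K)); apply/eqP.
  apply: (Cker 0) => //; rewrite scale0r sub0r -map_mxN -map_mxM.
  by move: hv; rewrite scale0r sub0r => ->; rewrite map_mx0.
- apply: pencil_index_le1 => v vE vz.
  (* By symmetry of [E], [v^T] is itself an admissible test vector, and testing with it gives a zero
     of the closed-loop dissipation form. *)
  have Ev : E *m v^T = 0 by apply: trmx_inj; rewrite trmx_mul trmxK pE.1 vE trmx0.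
  have [v1 v2 v3] : [/\ v *m (B *m SNp *m RS) = 0, v *m (B *m ZD) = 0
      & v *m (B *m F) = 0].
    apply: Rker; have := vz _ Ev; rewrite mulmxBr mulmxBl (skew_quad _ sJ) sub0r.
    by move/eqP; rewrite oppr_eq0 => /eqP.
  apply: h2; rewrite ?mul_mx_row ?v1 ?v2 ?row_mx0 //; apply/rowP => j.
  have Ej : E *m col j ZE = 0.
    by rewrite colE mulmxA (orthonormal_null_basis0 hZE) mul0mx.
  have := vz _ Ej; rewrite A'E mulmxDr v3 addr0 colE !mulmxA -colE.
  by move/matrixP/(_ 0 0); rewrite !mxE.
- move=> lam /eqP/det0P[v v0 hv]; rewrite ltNge; apply: contra v0 => l0.
  by rewrite (Cker lam v l0 hv).
Qed.
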